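(* Let $I=[-1,1]$ and let $\mathcal{P}^4_0(I)$ be the three-dimensional real vector space of polynomials of degree at most four that vanish at $x=-1$ and at $x=1$. There does not exist a nonnegative $H^1_0$-orthonormal basis for $\mathcal{P}^4_0(I)$; that is, there do not exist $\psi_2,\psi_3,\psi_4\in\mathcal{P}^4_0(I)$ forming an orthonormal basis of $\mathcal{P}^4_0(I)$ with respect to the inner product $$\langle p,q\rangle=\int_{-1}^1 p'(x)q'(x)\,dx$$ such that $\psi_j(x)\geq 0$ for all $x\in I$ and all $j\in\{2,3,4\}$.
   Context: The bilinear form $\langle\cdot,\cdot\rangle$ displayed in the claim is an inner product on $\mathcal{P}^4_0(I)$, called the $H^1_0(I)$-inner product. A polynomial is called nonnegative if it takes nonnegative values on all of $I$. *)

(* Defs.v *)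
From HB Require Import structures.
From mathcomp Require Import all_boot all_order all_algebra.
From mathcomp Require Import all_classical all_reals all_analysis.

Set Implicit Arguments.
Unset Strict Implicit.
Unset Printing Implicit Defensive.

Import Order.TTheory GRing.Theory Num.Theory.
Import numFieldNormedType.Exports.

Local Open Scope classical_set_scope.
Local Open Scope ring_scope.

Definition I (R : realType) : interval R := `[-1, 1].

(* The instance below is what makes [linfun (npoly_eval a)] agree with
   evaluation at a. *)
Definition npoly_eval (R : fieldType) (n : nat) (a : R) (p : {poly_n R}) : R^o :=
  (p : {poly R}).[a].

Fact npoly_eval_is_linear (R : fieldType) (n : nat) (a : R) :
  linear (@npoly_eval R n a).
Proof. by move=> k p q; rewrite /npoly_eval /= hornerD hornerZ. Qed.

HB.instance Definition _ (R : fieldType) (n : nat) (a : R) :=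
  GRing.isLinear.Build R {poly_n R} R^o _ (@npoly_eval R n a)
    (@npoly_eval_is_linear R n a).

(* {poly_5 R} bounds the size by 5, i.e. the degree by 4. *)
Definition P40 (R : realType) : {vspace {poly_5 R}} :=
  (lker (linfun (@npoly_eval R 5 (-1))) :&: lker (linfun (@npoly_eval R 5 1)))%VS.

Lemma mem_P40 (R : realType) (p : {poly_5 R}) :
  (p \in P40 R) =
  ((p : {poly R}).[-1] == 0) && ((p : {poly R}).[1] == 0).
Proof. by rewrite memv_cap !memv_ker !lfunE. Qed.

Lemma dim_P40 (R : realType) : \dim (P40 R) = 3%N.
Proof.
have dim1 (f : 'Hom({poly_5 R}, R^o)) (U : {vspace {poly_5 R}}) v :
    v \in U -> f v != 0 -> \dim (f @: U)%VS = 1%N.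
  move=> vU fv0; apply/eqP; rewrite eqn_leq; apply/andP; split.
    by rewrite (leq_trans (dimvS (subvf _))) // dimvf.
  rewrite lt0n dimv_eq0; apply: contra fv0 => /eqP fU0.
  by rewrite -memv0 -fU0 memv_img.
have := limg_ker_dim (linfun (@npoly_eval R 5 1))
                     (lker (linfun (@npoly_eval R 5 (-1)))).
have := limg_ker_dim (linfun (@npoly_eval R 5 (-1))) fullv.
rewrite (dim1 _ _ (npolyp 5 1)) ?memvf//; last first.
  by rewrite lfunE /= /npoly_eval npolypK ?size_poly1// hornerE oner_eq0.
rewrite (dim1 _ _ (npolyp 5 ('X - (-1)%:P))); first last.
- by rewrite lfunE /= /npoly_eval npolypK ?size_XsubC// !hornerE opprK
    (_ : 1 + 1 = 2%:R)// pnatr_eq0.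
- by rewrite memv_ker lfunE /= /npoly_eval npolypK ?size_XsubC// !hornerE subrr.
by rewrite capfv dim_polyn -/(P40 R) !addn1 => -[->] [].
Qed.

Definition H10 (R : realType) (p q : {poly R}) : R :=
  \int[@lebesgue_measure R]_(x in [set` I R]) (p^`().[x] * q^`().[x]).

Definition H10_orthonormal_basis (R : realType) (n : nat)
    (U : {vspace {poly_n R}}) (X : seq {poly_n R}) : Prop :=
  basis_of U X /\
  forall i j, (i < size X)%N -> (j < size X)%N ->
    H10 X`_i X`_j = (i == j)%:R.

Definition nonnegative (R : realType) (p : {poly R}) : Prop :=
  forall x : R, x \in I R -> 0 <= p.[x].

(* Main.v *)
Require Import Defs.
From mathcomp Require Import all_boot all_order all_algebra.
From mathcomp Require Import all_classical all_reals all_analysis.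
From mathcomp Require Import ring lra.

(** Why there is no such basis.  Write a polynomial of P40 as
    (1 - x^2) q(x) with q(x) = a + b x + c (x^2 - 1/5).  In the coordinates
    (a, b, c) the H10 product is diagonal, with weights 8/3, 8/5, 128/175
    ([H10_bubble]): 1 - x^2 and its multiples by x and x^2 - 1/5 are, up to
    scaling, antiderivatives of Legendre polynomials.

    The discriminant of q is a quadratic form in (a, b, c), so its sum over an
    orthonormal basis is its trace relative to the H10 product, the same
    number 55/32 for every orthonormal basis ([sum_discr]).  If all
    three q were nonnegative on [-1, 1], that sum would be smaller:
    - some q is strictly concave: the a- and c-coordinates of the three members
      are orthogonal, while a nonnegative convex q has a >= c/5 >= 0
      ([exists_concave]);
    - that q has discriminant below 55/32 ([discr_concave]);
    - every nonnegative q' orthogonal to it has discriminant at most 0: with a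
      positive discriminant, q' would have no minimum inside ]-1, 1[, and its
      product with a nonnegative strictly concave q would be positive
      ([concave_orthogonal_discr]). *)

Import Order.TTheory GRing.Theory Num.Theory.
Import numFieldNormedType.Exports.

Local Open Scope ring_scope.

(** * Polynomials on an interval *)

Lemma Rintegral_deriv_horner (R : realType) (F : {poly R}) (a b : R) :
  a < b ->
  \int[@lebesgue_measure R]_(x in `[a, b]%classic) (F^`()).[x] = F.[b] - F.[a].
Proof.
move=> ab; rewrite /Rintegral (@continuous_FTC2 _ _ (horner F))//.
- by apply: continuous_subspaceT => x; exact: continuous_horner.
- split=> [x _||]; first exact: derivable_horner.
  + by apply: cvg_at_right_filter; exact: continuous_horner.
  + by apply: cvg_at_left_filter; exact: continuous_horner.
- by move=> x _; rewrite -derive.derivE.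
Qed.

(** Needed because a polynomial of P40 vanishes at both endpoints, so its sign
    controls the cofactor of 1 - x^2 only inside the interval. *)
Lemma horner_ge0_itvcc (R : realType) (p : {poly R}) (a b : R) :
  a < b -> {in `]a, b[, forall x, 0 <= p.[x]} ->
  {in `[a, b], forall x, 0 <= p.[x]}.
Proof.
move=> ab p0 x; rewrite in_itv/= => /andP[].
rewrite le_eqVlt => /predU1P[<- _|ax].
  have cp : (p.[y] @[y --> a^'+] --> p.[a])%classic.
    by apply: cvg_at_right_filter; exact: continuous_horner.
  apply: (cvgr_to_ge cp).
  near=> y; apply: p0; rewrite in_itv/=; apply/andP; split.
    by near: y; exact: nbhs_right_gt.
  by near: y; exact: nbhs_right_lt.
rewrite le_eqVlt => /predU1P[->|xb]; last by apply: p0; rewrite in_itv/= ax.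
have cp : (p.[y] @[y --> b^'-] --> p.[b])%classic.
  by apply: cvg_at_left_filter; exact: continuous_horner.
apply: (cvgr_to_ge cp).
near=> y; apply: p0; rewrite in_itv/=; apply/andP; split.
  by near: y; exact: nbhs_left_gt.
by near: y; exact: nbhs_left_lt.
Unshelve. all: by end_near. Qed.

(** * Coordinates on P40 *)

(** The shift by 1/5 makes the H10 product diagonal in these coordinates. *)
Definition quad {R : fieldType} (u : 'rV[R]_3) : {poly R} :=
  (u 0 0)%:P + (u 0 1)%:P * 'X + (u 0 2%:R)%:P * ('X ^+ 2 - (5%:R^-1)%:P).

Definition bubble {R : fieldType} (u : 'rV[R]_3) : {poly R} :=
  (1 - 'X ^+ 2) * quad u.

Lemma horner_quad (R : fieldType) (u : 'rV[R]_3) (x : R) :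
  (quad u).[x] = u 0 0 + u 0 1 * x + u 0 2%:R * (x ^+ 2 - 5%:R^-1).
Proof. by rewrite /quad !hornerE. Qed.

Lemma mem_P40_bubble (R : realType) (p : {poly_5 R}) :
  p \in P40 R -> exists u : 'rV[R]_3, (p : {poly R}) = bubble u.
Proof.
rewrite mem_P40 => /andP[].
have sp : (size (p : {poly R}) <= 5)%N by exact: size_npoly.
have -> : (p : {poly R}) = \poly_(i < 5) (p : {poly R})`_i.
  apply/polyP => i; rewrite coef_poly.
  by case: ltnP => // /(leq_trans sp) /(nth_default 0).
move: (p : {poly R}) => {sp} {}p.
rewrite poly_def !big_ord_recr big_ord0/= !hornerE/= => /eqP e1 /eqP e2.
set a := p`_0 in e1 e2 *; set b := p`_1 in e1 e2 *; set c := p`_2 in e1 e2 *.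
set d := p`_3 in e1 e2 *; set e := p`_4 in e1 e2 *.
(* By e1 and e2, p = (1 - x^2) (a + b x - e x^2); absorb the shift by 1/5. *)
exists (\row_i [:: a - e / 5%:R; b; - e]`_i).
rewrite /bubble /quad !mxE/=.
have -> : d = - b by lra.
have -> : c = - a - e by lra.
rewrite -!mul_polyC.
have e5 : (e / 5%:R)%:P = e%:P * (5%:R^-1)%:P by rewrite polyCM.
rewrite !(polyCB, polyCN) e5.
ring.
Qed.

Lemma nonnegative_bubble (R : realType) (u : 'rV[R]_3) :
  nonnegative (bubble u) -> {in `[-1, 1], forall x, 0 <= (quad u).[x]}.
Proof.
move=> u0; apply: horner_ge0_itvcc; first by lra.
move=> x; rewrite in_itv/= => /andP[x1 x2].
have : 0 <= (bubble u).[x] by apply: u0; rewrite in_itv/= !ltW.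
rewrite /bubble hornerM pmulr_rge0// !hornerE/=; nra.
Qed.

Definition weight (R : fieldType) : 'rV[R]_3 :=
  \row_k [:: 8%:R / 3%:R; 8%:R / 5%:R; 128%:R / 175%:R]`_k.

Definition wdot {R : fieldType} (u v : 'rV[R]_3) : R :=
  \sum_k weight R 0 k * (u 0 k * v 0 k).

Lemma wdotE (R : fieldType) (u v : 'rV[R]_3) :
  wdot u v = 8%:R / 3%:R * (u 0 0 * v 0 0) + 8%:R / 5%:R * (u 0 1 * v 0 1)
             + 128%:R / 175%:R * (u 0 2%:R * v 0 2%:R).
Proof.
rewrite /wdot !big_ord_recl big_ord0 !mxE/= addr0 addrA.
congr (_ * (u 0 _ * v 0 _) + _ * (u 0 _ * v 0 _) + _ * (u 0 _ * v 0 _));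
  exact/val_inj.
Qed.

Lemma H10_bubble (R : realType) (u v : 'rV[R]_3) :
  H10 (bubble u) (bubble v) = wdot u v.
Proof.
rewrite wdotE /H10 /bubble /quad.
move: (u 0 0) (u 0 1) (u 0 2%:R) (v 0 0) (v 0 1) (v 0 2%:R) => a b c a' b' c'.
(* The derivative of (1 - x^2) (a + b x + c (x^2 - 1/5)) is
   b + e x - 3 b x^2 - 4 c x^3; F is the antiderivative of the product. *)
pose e := 12%:R / 5%:R * c - 2%:R * a.
pose e' := 12%:R / 5%:R * c' - 2%:R * a'.
pose F : {poly R} := (b * b')%:P * 'X
 + ((b * e' + e * b') / 2%:R)%:P * 'X^2
 + ((e * e' - 6%:R * b * b') / 3%:R)%:P * 'X^3
 + (- (b * c' + c * b') - 3%:R / 4%:R * (b * e' + e * b'))%:P * 'X^4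
 + ((9%:R * b * b' - 4%:R * (e * c' + c * e')) / 5%:R)%:P * 'X^5
 + (2%:R * (b * c' + c * b'))%:P * 'X^6
 + (16%:R / 7%:R * c * c')%:P * 'X^7.
transitivity (F.[1] - F.[-1]); last by rewrite /F !hornerE /= /e /e'; field.
rewrite -Rintegral_deriv_horner; last lra.
apply: eq_Rintegral => x _.
by rewrite /F !poly.derivE !hornerE /= /e /e'; field.
Qed.

(** If M W M^T = 1 for the diagonal weight matrix W, then W M^T M = 1: the rows
    of M being orthonormal determines all the sums of products of two
    columns. *)
Lemma orthonormal_cols (R : fieldType) (M : 'M[R]_3) :
  (forall i j, wdot (row i M) (row j M) = (i == j)%:R) ->
  forall k l, weight R 0 k * (\sum_i M i k * M i l) = (k == l)%:R.
Proof.
move=> H k l.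
have MW : M *m (diag_mx (weight R) *m M^T) = 1%:M.
  apply/matrixP => i j; rewrite !mxE -H; apply: eq_bigr => m _.
  by rewrite mul_diag_mx 4!mxE mulrCA !mxE.
have := mulmx1C MW; rewrite -mulmxA mul_diag_mx => /matrixP/(_ k l).
rewrite !mxE => <-; congr (_ * _); apply: eq_bigr => i _.
by rewrite !mxE.
Qed.

(** * The discriminant form *)

Definition discr {R : fieldType} (u : 'rV[R]_3) : R :=
  u 0 1 ^+ 2 - 4%:R * u 0 2%:R * (u 0 0 - u 0 2%:R / 5%:R).

(** The sum is the trace of the form relative to [wdot]: b^2 contributes 5/8 and
    (4/5) c^2 contributes (4/5) (175/128) = 35/32; the mixed term in a c has no
    trace since the product is diagonal. *)
Lemma sum_discr (R : realFieldType) (M : 'M[R]_3) :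
  (forall i j, wdot (row i M) (row j M) = (i == j)%:R) ->
  \sum_i discr (row i M) = 55%:R / 32%:R.
Proof.
move=> orth.
have MM := orthonormal_cols _ _ orth.
have := MM 1 1; have := MM 2%:R 2%:R; have := MM 2%:R 0.
rewrite !big_ord_recl !big_ord0 /discr !mxE/=.
nra.
Qed.

Lemma quad_ge0_center (R : realFieldType) (u : 'rV[R]_3) :
  {in `[-1, 1], forall x, 0 <= (quad u).[x]} ->
  u 0 2%:R <= 5%:R * u 0 0.
Proof.
move=> u0.
have := u0 0; rewrite in_itv/= lerN10 ler01 horner_quad => /(_ isT).
lra.
Qed.

Lemma quad_ge0_ends (R : realFieldType) (u : 'rV[R]_3) :
  {in `[-1, 1], forall x, 0 <= (quad u).[x]} ->
  `|u 0 1| <= u 0 0 + 4%:R / 5%:R * u 0 2%:R.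
Proof.
move=> u0.
have := u0 1; rewrite in_itv/= lexx ge0_cp// horner_quad => /(_ isT).
have := u0 (-1); rewrite in_itv/= lexx ge0_cp// horner_quad => /(_ isT).
by rewrite ler_norml => ? ?; apply/andP; split; lra.
Qed.

(** The value at the vertex - b / (2 c) is - discr u / (4 c): a nonnegative
    quadratic with positive discriminant has no minimum inside ]-1, 1[. *)
Lemma quad_ge0_discr (R : realFieldType) (u : 'rV[R]_3) :
  {in `[-1, 1], forall x, 0 <= (quad u).[x]} ->
  0 < discr u -> 2%:R * u 0 2%:R <= `|u 0 1|.
Proof.
move=> u0.
rewrite !ltNge; apply: contraNle.
rewrite ltr_norml => /andP[h1 h2].
set b := u 0 1 in h1 h2 *; set c := u 0 2%:R in h1 h2 *.
have c0 : 0 < c by lra.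
have := u0 (- b / (2%:R * c)).
rewrite in_itv/= horner_quad -/b -/c ler_pdivlMr ?ler_pdivrMr ?mulr_gt0//.
rewrite (_ : _ && _); last by apply/andP; split; lra.
move=> /(_ isT).
rewrite (_ : _ + _ = - discr u / (4%:R * c)); last first.
  rewrite /discr -/b -/c; field; lra.
by rewrite pmulr_lge0 ?invr_gt0 ?mulr_gt0// oppr_ge0.
Qed.

(** Otherwise the bounds |b'| >= 2 c', |b'| <= a' + (4/5) c' hold for v, and
    |b| <= a + (4/5) c for u.  With s = a + (4/5) c >= 0, replacing b b' by
    - s |b'| bounds [wdot u v] below by
      s ((8/3) a' - (8/5) |b'|) - c ((32/15) a' - (128/175) c'),
    where the factor of s is nonnegative and that of - c positive. *)
Lemma concave_orthogonal_discr (R : realFieldType) (u v : 'rV[R]_3) :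
  {in `[-1, 1], forall x, 0 <= (quad u).[x]} ->
  {in `[-1, 1], forall x, 0 <= (quad v).[x]} ->
  u 0 2%:R < 0 -> wdot u v = 0 -> discr v <= 0.
Proof.
move=> /quad_ge0_ends ue v0 uc uv; rewrite leNgt; apply/negP => dv.
have := quad_ge0_discr _ _ v0 dv; have := quad_ge0_ends _ _ v0.
have bb : - (`|u 0 1| * `|v 0 1|) <= u 0 1 * v 0 1.
  by rewrite -normrM lerNl -normrN ler_norm.
move: uv ue uc bb dv; rewrite wdotE /discr.
have := normr_ge0 (u 0 1); have := normr_ge0 (v 0 1).
have : v 0 1 <= `|v 0 1| by exact: ler_norm.
have : - v 0 1 <= `|v 0 1| by rewrite -normrN; exact: ler_norm.
move: (u 0 0) (u 0 1) (u 0 2%:R) `|u 0 1| => a b c B.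
move: (v 0 0) (v 0 1) (v 0 2%:R) `|v 0 1| => a' b' c' B'.
move=> bB1 bB2 B'0 B0 uv ue c0 bb dv ve vd.
have a'B : 3%:R / 5%:R * B' <= a' by lra.
have ac' : 0 < 32%:R / 15%:R * a' - 128%:R / 175%:R * c'.
  have [c'0|c'0|c'0] := ltrgtP c' 0; [lra|lra|].
  have [|a'0] := ltP 0 a'; first lra.
  have b'0 : b' = 0 by lra.
  by move: dv; rewrite b'0 c'0 expr0n/= mulr0 mul0r subrr ltxx.
have := mulr_gt0 (_ : 0 < - c) ac'; rewrite oppr_gt0 => /(_ c0) h1.
have s0 : 0 <= a + 4%:R / 5%:R * c by lra.
have h2 : 0 <= (a + 4%:R / 5%:R * c) * (8%:R / 3%:R * a' - 8%:R / 5%:R * B').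
  by rewrite mulr_ge0//; lra.
have h3 : 0 <= (a + 4%:R / 5%:R * c - B) * B' by rewrite mulr_ge0//; lra.
have : 0 < 8%:R / 3%:R * (a * a') + 8%:R / 5%:R * (b * b')
           + 128%:R / 175%:R * (c * c') by lra.
by rewrite uv ltxx.
Qed.

(** The form (55/32) [wdot u u] - [discr u] is
    (55/12) a^2 + (7/4) b^2 + (16/35) c^2 + 4 a c, positive
    for 0 < - c <= (5/4) a, the bound on - c being nonnegativity at 1 and -1. *)
Lemma discr_concave (R : realFieldType) (u : 'rV[R]_3) :
  {in `[-1, 1], forall x, 0 <= (quad u).[x]} ->
  u 0 2%:R < 0 -> wdot u u = 1 -> discr u < 55%:R / 32%:R.
Proof.
move=> /quad_ge0_ends ue uc; rewrite wdotE /discr.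
have := le_trans (normr_ge0 _) ue.
move: (u 0 0) (u 0 1) (u 0 2%:R) uc => a b c c0 ac e.
have: 0 <= (a + 4%:R / 5%:R * c) * - c by rewrite mulr_ge0//; lra.
nra.
Qed.

(** If every c were nonnegative, each product a c would be at least c^2 / 5;
    the columns of a and c being orthogonal, all c would vanish, whereas their
    squares sum to 175/128. *)
Lemma exists_concave (R : realFieldType) (M : 'M[R]_3) :
  (forall i j, wdot (row i M) (row j M) = (i == j)%:R) ->
  (forall i, {in `[-1, 1], forall x, 0 <= (quad (row i M)).[x]}) ->
  exists i, M i 2%:R < 0.
Proof.
move=> orth M0.
have [/existsP//|/existsPn c0] := boolP [exists i, M i 2%:R < 0].
have MM := orthonormal_cols _ _ orth.
have w0 : weight R 0 2%:R != 0 by rewrite mxE/= mulf_neq0 ?invr_eq0 ?pnatr_eq0.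
have /eqP := MM 2%:R 0; rewrite mulf_eq0 (negPf w0)/= => /eqP ac.
have := MM 2%:R 2%:R.
rewrite big1 ?mulr0 => [/eqP|i _]; first by rewrite eq_sym oner_eq0.
have cle j : M j 2%:R <= 5%:R * M j 0.
  by have := quad_ge0_center _ _ (M0 j); rewrite !mxE.
have ge0 j : true -> 0 <= M j 2%:R * M j 0.
  have := c0 j; have := cle j; rewrite -leNgt => ? ?.
  by rewrite mulr_ge0//; lra.
have /(_ ac i isT) := psumr_eq0P ge0.
have := cle i; have := c0 i; rewrite -leNgt; nra.
Qed.

Theorem theorem3p11 (R : realType) :
  ~ exists psi2 psi3 psi4 : {poly_5 R},
      H10_orthonormal_basis (P40 R) [:: psi2; psi3; psi4] /\
      [/\ nonnegative psi2, nonnegative psi3 & nonnegative psi4].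
Proof.
move=> [p2 [p3 [p4 [[bas orth] [n2 n3 n4]]]]].
have inP p : p \in [:: p2; p3; p4] -> exists u, (p : {poly R}) = bubble u.
  by move=> /(basis_mem bas); exact: mem_P40_bubble.
have [u2 e2] : exists u, (p2 : {poly R}) = bubble u.
  by apply: inP; rewrite !inE eqxx.
have [u3 e3] : exists u, (p3 : {poly R}) = bubble u.
  by apply: inP; rewrite !inE eqxx orbT.
have [u4 e4] : exists u, (p4 : {poly R}) = bubble u.
  by apply: inP; rewrite !inE eqxx !orbT.
pose p (i : 'I_3) := [:: p2; p3; p4]`_i.
pose M : 'M[R]_3 := \matrix_(i < 3) ([:: u2; u3; u4]`_i).
have pE i : (p i : {poly R}) = bubble (row i M).
  by rewrite rowK /p; case: i => [[|[|[|]]]].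
have {}orth i j : wdot (row i M) (row j M) = (i == j)%:R.
  by rewrite -H10_bubble -!pE orth.
have M0 i : {in `[-1, 1], forall x, 0 <= (quad (row i M)).[x]}.
  apply: nonnegative_bubble; rewrite -pE /p.
  by case: i => [[|[|[|]]]].
have [i ci] := exists_concave _ _ orth M0.
have ci' : row i M 0 2%:R < 0 by rewrite mxE.
suff : \sum_i discr (row i M) < 55%:R / 32%:R by rewrite sum_discr// ltxx.
rewrite (bigD1 i)//= -[ltRHS]addr0 ltr_leD//.
  by apply: discr_concave => //; rewrite orth eqxx.
apply: sumr_le0 => j ji; apply: (concave_orthogonal_discr _ _ _ (M0 i)) => //.
by rewrite orth eq_sym (negPf ji).
Qed.
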